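(* There is a universal constant $K>0$ such that the following holds. Let $F$ be a non-abelian free group of finite rank, let $\varphi_\alpha\in\ell^1_{Ind}$, let $\phi_\lambda$ be a Rolli quasimorphism of $F$, and let $\psi:=\sum_{w}\beta_wH_w$, where $(\beta_w)_{1\ne w\in F}$ are real coefficients such that $S:=\sum_w|w|\,|\beta_w|\,D(H_w)<\infty$. 1. $[\delta^1\varphi_\alpha]\smile[\delta^1\psi]=0\in H^4_b(F)$, with a primitive of $\delta^1\varphi_\alpha\smile\delta^1\psi$ of norm at most $K\,SInd_\alpha\cdot S$. 2. $[\delta^1\phi_\lambda]\smile[\delta^1\psi]=0\in H^4_b(F)$, with a primitive of $\delta^1\phi_\lambda\smile\delta^1\psi$ of norm at most $K\,\|\lambda\|_\infty\cdot S$.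
   Context: Bounded cohomology. $C^n_b(F)$ is the space of bounded functions $F^n\to\mathbb{R}$ with the sup norm ($C^0_b=\mathbb{R}$). The coboundary is $\delta^n f(g_1,\dots,g_{n+1})=f(g_2,\dots,g_{n+1})+\sum_{i=1}^n(-1)^i f(g_1,\dots,g_ig_{i+1},\dots,g_{n+1})+(-1)^{n+1}f(g_1,\dots,g_n)$ ($\delta^0=0$), defined also on unbounded functions; $H^n_b(F)=\ker(\delta^n|_{C^n_b})/\delta^{n-1}(C^{n-1}_b(F))$. The cup product is induced by $(f\smile f')(g_1,\dots,g_{n+m})=f(g_1,\dots,g_n)f'(g_{n+1},\dots,g_{n+m})$. For $\varphi:F\to\mathbb{R}$, $\delta^1\varphi(g,h)=\varphi(g)+\varphi(h)-\varphi(gh)$ and $D(\varphi)=\sup_{g,h}|\delta^1\varphi(g,h)|$ is the defect; $\varphi$ is a quasimorphism if $D(\varphi)<\infty$, and then $[\delta^1\varphi]\in H^2_b(F)$. A primitive of a coboundary $f\in\delta^3(C^3_b(F))$ is a $\pi\in C^3_b(F)$ with $\delta^3\pi=f$; its norm is $\|\pi\|_\infty$. Words. $F$ has a fixed basis $S_0=\{s_1,\dots,s_n\}$; elements are reduced words, $|w|$ is word length, a product is reduced if there is no cancellation. $w$ is a subword of $g$ if $g=uwv$ as a reduced product; it is proper if $w\ne g$. Words $w_1,w_2$ overlap properly if, for some $i\in\{1,2\}$, $w_i=xy$ and $w_{3-i}=yz$ as reduced products with $x,y,z\neq1$; they overlap if they overlap properly or one is a proper subword of the other. $w$ is self-overlapping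 if it overlaps itself; $\mathcal{N}$ is the set of non-self-overlapping words. For any $w\ne1$ (possibly self-overlapping) the big Brooks quasimorphism is $H_w(g)=$ (number of possibly overlapping occurrences of $w$ as a subword of $g$) $-$ (number of such occurrences of $w^{-1}$); for $w\in\mathcal N$ put $h_w=H_w$. A family $I\subset F$ is independent if no two words in $I$ overlap (so all its words are non-self-overlapping), symmetric if $I=I^{-1}$. The sum defining $\psi$ is finite at each $g\in F$, since $H_w(g)=0$ for $|w|>|g|$. $\ell^1_{Ind}$. Let $\alpha:F\to\mathbb{R}$ be alternating ($\alpha_{w^{-1}}=-\alpha_w$) and supported on $\mathcal N$; with $\mathcal N^+\subset\mathcal N$ containing exactly one of $w,w^{-1}$ for each $1\neq w\in\mathcal N$, $\varphi_\alpha:=\sum_{w\in\mathcal N^+}\alpha_wh_w$. $\ell^1_{Ind}$ is the set of $\varphi_\alpha$ such that $\alpha=\sum_{i\ge1}\alpha_i$ with each $\alpha_i$ bounded, alternating, supported on a symmetric independent family $I_i$, and $\sum_i\|\alpha_i\|_\infty<\infty$; $SInd_\alpha$ is the infimum of $\sum_i\|\alpha_i\|_\infty$ over all such expressions. Rolli quasimorphisms. For $\lambda=(\lambda_1,\dots,\lambda_n)$ with $\lambda_i:\mathbb{Z}\to\mathbb{R}$ bounded and alternating, $\phi_\lambda(g)=\sum_j\lambda_{i_j}(m_j)$, where $g=\prod_j s_{i_j}^{m_j}$ is the unique expression with $s_{i_j}\neq s_{i_{j+1}}$, $m_j\in\mathbb{Z}\setminus\{0\}$ ($\phi_\lambda(1)=0$).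 $\|\lambda\|_\infty=\max_i\|\lambda_i\|_\infty$. *)

(* Defs.v *)
From HB Require Import structures.
From mathcomp Require Import all_boot all_order all_algebra all_fingroup.
From mathcomp Require Import all_classical all_reals all_analysis.
From mathcomp Require Import zify.

Set Implicit Arguments.
Unset Strict Implicit.
Unset Printing Implicit Defensive.

Import Order.TTheory GRing.Theory Num.Theory.
Import numFieldNormedType.Exports.

Local Open Scope classical_set_scope.
Local Open Scope ring_scope.

(** * Free groups as groups of reduced words *)

(* [(i, false)] stands for the basis element s_i, [(i, true)] for its inverse. *)
Definition letter (n : nat) := ('I_n * bool)%type.

Definition invl n (a : letter n) : letter n := (a.1, ~~ a.2).

Definition reduced n (s : seq (letter n)) : bool :=
  sorted (fun a b => b != invl a) s.

Record FreeGroup (n : nat) := MkFreeGroup {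
  word :> seq (letter n);
  word_reduced : reduced word
}.

HB.instance Definition _ n := [isSub of FreeGroup n for @word n].
HB.instance Definition _ n := [Choice of FreeGroup n by <:].

Definition push n (a : letter n) (s : seq (letter n)) : seq (letter n) :=
  if s is b :: s' then if b == invl a then s' else a :: s else [:: a].

Definition mulw n (s t : seq (letter n)) : seq (letter n) := foldr (@push n) t s.

Definition invw n (s : seq (letter n)) : seq (letter n) := rev (map (@invl n) s).

Lemma invlK n : involutive (@invl n).
Proof. by case=> i b; rewrite /invl /= negbK. Qed.

Lemma reduced_behead n a (s : seq (letter n)) : reduced (a :: s) -> reduced s.
Proof. exact: path_sorted. Qed.

Lemma push_reduced n a (s : seq (letter n)) : reduced s -> reduced (push a s).
Proof.
case: s => [|b s] //= rs; case: ifP => [_|/negbT nb]; first exact: path_sorted rs.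
by rewrite /reduced /= nb.
Qed.

Lemma mulw_reduced n (s t : seq (letter n)) : reduced t -> reduced (mulw s t).
Proof. by move=> rt; elim: s => //= a s IH; apply: push_reduced. Qed.

Lemma invw_reduced n (s : seq (letter n)) : reduced s -> reduced (invw s).
Proof.
move=> rs; rewrite /reduced /invw rev_sorted sorted_map.
apply: sub_sorted rs => a b /= ba; apply: contra ba => /eqP e.
by rewrite -(invlK b) -e.
Qed.

Lemma push_reducedE n a (s : seq (letter n)) : reduced (a :: s) -> push a s = a :: s.
Proof. by case: s => [|b s] //= /andP[/negbTE ->]. Qed.

Lemma push_invl n a (s : seq (letter n)) : reduced s -> push a (push (invl a) s) = s.
Proof.
case: s => [|b s] /=; first by rewrite eqxx.
rewrite invlK; case: eqP => [->|_] rs; last by rewrite /= eqxx.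
exact: push_reducedE.
Qed.

Lemma mulw_push n a (s t : seq (letter n)) :
  reduced t -> mulw (push a s) t = push a (mulw s t).
Proof.
case: s => [|b s] //= rt; case: eqP => [->|//] /=.
by rewrite push_invl // mulw_reduced.
Qed.

Lemma mulwA n (s t u : seq (letter n)) :
  reduced u -> mulw s (mulw t u) = mulw (mulw s t) u.
Proof. by move=> ru; elim: s => //= a s ->; rewrite mulw_push. Qed.

Lemma mulw0 n (s : seq (letter n)) : reduced s -> mulw s [::] = s.
Proof.
elim: s => //= a s IH rs.
by rewrite IH ?push_reducedE //; apply: reduced_behead rs.
Qed.

Lemma mulVw n (s : seq (letter n)) : mulw (invw s) s = [::].
Proof.
rewrite -[X in mulw _ X]cats0; move: [::] => t.
elim: s => //= a s IH.
by rewrite /invw /= rev_cons -cats1 /mulw foldr_cat /= invlK eqxx.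
Qed.

Lemma invwK n (s : seq (letter n)) : invw (invw s) = s.
Proof. by rewrite /invw map_rev revK mapK //; apply: invlK. Qed.

Definition fg_one n : FreeGroup n := @MkFreeGroup n [::] isT.
Definition fg_inv n (g : FreeGroup n) : FreeGroup n :=
  MkFreeGroup (invw_reduced (word_reduced g)).
Definition fg_mul n (g h : FreeGroup n) : FreeGroup n :=
  MkFreeGroup (mulw_reduced g (word_reduced h)).

Fact fg_mulA n : associative (@fg_mul n).
Proof. by move=> g h k; apply/val_inj/mulwA/word_reduced. Qed.

Fact fg_mul1 n : left_id (@fg_one n) (@fg_mul n).
Proof. by move=> g; apply/val_inj. Qed.

Fact fg_mulr1 n : right_id (@fg_one n) (@fg_mul n).
Proof. by move=> g; apply/val_inj/mulw0/word_reduced. Qed.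

Fact fg_mulV n : left_inverse (@fg_one n) (@fg_inv n) (@fg_mul n).
Proof. by move=> g; apply/val_inj/mulVw. Qed.

Fact fg_mulrV n : right_inverse (@fg_one n) (@fg_inv n) (@fg_mul n).
Proof. by move=> g; apply/val_inj; rewrite /= -{1}(invwK g) mulVw. Qed.

HB.instance Definition _ n := isGroup.Build (FreeGroup n)
  (@fg_mulA n) (@fg_mul1 n) (@fg_mulr1 n) (@fg_mulV n) (@fg_mulrV n).

Definition gen n (i : 'I_n) : FreeGroup n := @MkFreeGroup n [:: (i, false)] isT.

Lemma wordM n (g h : FreeGroup n) : word (g * h)%g = mulw (word g) (word h).
Proof. by []. Qed.

(* The product [g * h] is reduced exactly when the words just concatenate. *)
Lemma wordM_reduced n (g h : FreeGroup n) :
  word (g * h)%g = word g ++ word h <-> reduced (word g ++ word h).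
Proof.
split=> [<-|]; first exact: word_reduced.
rewrite wordM; elim: (word g) => [|a s IH] //= r.
by rewrite IH ?push_reducedE //; apply: reduced_behead r.
Qed.

(** * Bounded cohomology *)

Section Sup.
Local Open Scope ereal_scope.

Definition sup_norm (R : realType) (T : Type) (f : T -> R) : \bar R :=
  ereal_sup (range (fun x => `|f x|%:E)).

End Sup.

Definition cochain (R : realType) (G : groupType) (n : nat) := n.-tuple G -> R.

Definition tuple_init (T : Type) n (g : n.+1.-tuple T) : n.-tuple T :=
  [tuple tnth g (widen_ord (leqnSn n) j) | j < n].

(* (g_0, .., g_n) |-> (g_0, .., g_i g_{i+1}, .., g_n); indices start at 0 *)
Definition tuple_contract (G : groupType) n (i : 'I_n) (g : n.+1.-tuple G) :
    n.-tuple G :=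
  [tuple if (j < i)%N then tnth g (widen_ord (leqnSn n) j)
         else if j == i
           then (tnth g (widen_ord (leqnSn n) j) * tnth g (lift ord0 j))%g
         else tnth g (lift ord0 j) | j < n].

Definition coboundary (R : realType) (G : groupType) n (f : cochain R G n) :
    cochain R G n.+1 := fun g =>
  f (behead_tuple g)
  + \sum_(i < n) (-1) ^+ i.+1 * f (tuple_contract i g)
  + (-1) ^+ n.+1 * f (tuple_init g).

Definition cup (R : realType) (G : groupType) n m
    (f : cochain R G n) (f' : cochain R G m) : cochain R G (n + m) := fun g =>
  f [tuple tnth g (lshift m i) | i < n] * f' [tuple tnth g (rshift n j) | j < m].

Definition bounded_cochains (R : realType) (G : groupType) n : set (cochain R G n) :=
  [set f | (sup_norm f < +oo)%E].

Definition bounded_cocycles (R : realType) (G : groupType) n : set (cochain R G n) :=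
  [set f | bounded_cochains f /\ coboundary f = (fun=> 0)].

Definition bounded_coboundaries (R : realType) (G : groupType) n :
    set (cochain R G n) :=
  match n with
  | 0 => [set (fun=> 0)]
  | k.+1 => [set coboundary b | b in @bounded_cochains R G k]
  end.

(* The elements of H^n_b are the cosets of the bounded coboundaries in the
   bounded cocycles. *)
Definition Hb_class (R : realType) (G : groupType) n (f : cochain R G n) :
    set (cochain R G n) :=
  [set f' | bounded_cocycles f' /\ bounded_coboundaries (f' \- f)].

Definition Hb (R : realType) (G : groupType) n : set (set (cochain R G n)) :=
  [set Hb_class f | f in @bounded_cocycles R G n].

Definition Hb_zero (R : realType) (G : groupType) n : set (cochain R G n) :=
  Hb_class (fun=> 0).

(* Union over all representatives; it is a single coset by the Leibniz rule. *)
Definition Hb_cup (R : realType) (G : groupType) n m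
    (A : set (cochain R G n)) (B : set (cochain R G m)) :
    set (cochain R G (n + m)) :=
  [set h | exists f f', [/\ A f, B f' & Hb_class (cup f f') h]].

Definition is_primitive (R : realType) (G : groupType)
    (f : cochain R G 4) (p : cochain R G 3) : Prop :=
  bounded_cochains p /\ coboundary p = f.

Definition delta1 (R : realType) (G : groupType) (phi : G -> R) : cochain R G 2 :=
  coboundary (fun g : 1.-tuple G => phi (thead g)).

Lemma delta1E (R : realType) (G : groupType) (phi : G -> R) (g h : G) :
  delta1 phi [tuple g; h] = phi g + phi h - phi (g * h)%g.
Proof.
rewrite /delta1 /coboundary big_ord1 /= expr1 expr2 mulN1r mulrNN mulr1 mul1r.
rewrite /thead !tnth_mktuple /= !(tnth_nth 1%g) /=.
by rewrite addrAC [phi h + _]addrC.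
Qed.

Definition defect (R : realType) (G : groupType) (phi : G -> R) : \bar R :=
  sup_norm (delta1 phi).

Definition quasimorphism (R : realType) (G : groupType) (phi : G -> R) : Prop :=
  (defect phi < +oo)%E.

(** * Brooks quasimorphisms *)

Definition proper_subword n (w g : FreeGroup n) : Prop :=
  (exists u v : FreeGroup n, word g = word u ++ word w ++ word v) /\ w <> g.

Definition overlap_properly n (w1 w2 : FreeGroup n) : Prop :=
  exists x y z : FreeGroup n, [/\ x <> 1%g, y <> 1%g, z <> 1%g &
    (word w1 = word x ++ word y /\ word w2 = word y ++ word z) \/
    (word w2 = word x ++ word y /\ word w1 = word y ++ word z)].

Definition overlap n (w1 w2 : FreeGroup n) : Prop :=
  [\/ overlap_properly w1 w2, proper_subword w1 w2 | proper_subword w2 w1].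

Definition non_self_overlapping n : set (FreeGroup n) := [set w | ~ overlap w w].

Definition independent n (I : set (FreeGroup n)) : Prop :=
  forall w1 w2, I w1 -> I w2 -> ~ overlap w1 w2.

Definition symmetric_family n (I : set (FreeGroup n)) : Prop :=
  forall w, I w^-1%g <-> I w.

Definition occurrences n (w g : FreeGroup n) : nat :=
  count (fun i => prefix (word w) (drop i (word g))) (iota 0 (size (word g))).

Definition Brooks (R : realType) n (w g : FreeGroup n) : R :=
  (occurrences w g)%:R - (occurrences w^-1%g g)%:R.

Lemma Brooks_eq0 (R : realType) n (w g : FreeGroup n) :
  (size (word g) < size (word w))%N -> Brooks R w g = 0.
Proof.
have occ0 v : (size (word g) < size (word v))%N -> occurrences v g = 0%N.
  move=> vg; apply/eqP; rewrite -leqn0 leqNgt -has_count; apply/hasPn => i _.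
  apply: contraL vg => /prefixP[t e]; rewrite -leqNgt.
  by apply: leq_trans (leq_subr i _); rewrite -size_drop e size_cat leq_addr.
move=> wg; rewrite /Brooks !occ0 ?subrr //.
by rewrite /= /invw size_rev size_map.
Qed.

Lemma finite_words n k : finite_set [set w : FreeGroup n | (size (word w) <= k)%N].
Proof.
have fin : finite_set (\bigcup_(j in `I_k.+1) range (@tval j (letter n))).
  by apply: bigcup_finite => // j _; apply: finite_image; exact: finite_finset.
apply: (@sub_finite_set _ _ (@word n @^-1` _)); last first.
  by apply: finite_preimage fin => u v _ _; exact: val_inj.
by move=> w /= wk; exists (size (word w)) => //; exists (in_tuple (word w)).
Qed.

Lemma finite_Brooks (R : realType) n (c : FreeGroup n -> R) (g : FreeGroup n) :
  finite_set [set w | c w * Brooks R w g != 0].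
Proof.
apply: sub_finite_set (finite_words n (size (word g))) => w /=.
by apply: contraR; rewrite -ltnNge => /(Brooks_eq0 R) ->; rewrite mulr0.
Qed.

(** * The space l^1_Ind *)

Definition alternating (R : realType) n (alpha : FreeGroup n -> R) : Prop :=
  forall w, alpha w^-1%g = - alpha w.

Definition supported_on (R : realType) n (alpha : FreeGroup n -> R)
    (I : set (FreeGroup n)) : Prop :=
  forall w, alpha w != 0 -> I w.

Definition half_system n (P : set (FreeGroup n)) : Prop :=
  P `<=` @non_self_overlapping n /\
  forall w, w <> 1%g -> non_self_overlapping w ->
    (P w /\ ~ P w^-1%g) \/ (~ P w /\ P w^-1%g).

(* The sum is locally finite by [finite_Brooks]. *)
Definition phi_alpha (R : realType) n (P : set (FreeGroup n))
    (alpha : FreeGroup n -> R) (g : FreeGroup n) : R :=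
  \sum_(w \in P) alpha w * Brooks R w g.

Definition ind_decomposition (R : realType) n (alpha : FreeGroup n -> R)
    (a : nat -> FreeGroup n -> R) : Prop :=
  [/\ forall i, exists I : set (FreeGroup n),
        [/\ symmetric_family I, independent I, alternating (a i),
            supported_on (a i) I & (sup_norm (a i) < +oo)%E],
      (\sum_(0 <= i <oo) sup_norm (a i) < +oo)%E &
      forall w, series (fun i => a i w) @ \oo --> alpha w].

(* Membership of [phi_alpha P alpha] in l^1_Ind; this is independent of [P]. *)
Definition ell1_Ind (R : realType) n (alpha : FreeGroup n -> R) : Prop :=
  [/\ alternating alpha, supported_on alpha (@non_self_overlapping n) &
      exists a, ind_decomposition alpha a].

Definition SInd (R : realType) n (alpha : FreeGroup n -> R) : \bar R :=
  ereal_inf [set (\sum_(0 <= i <oo) sup_norm (a i))%E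
            | a in ind_decomposition alpha].

(** * Rolli quasimorphisms *)

(* The syllables (i_j, m_j) of a reduced word; see [syllablesP]. *)
Definition syllable_cons n (a : letter n) (t : seq ('I_n * int)) :
    seq ('I_n * int) :=
  if t is (i, m) :: t' then
    if i == a.1 then (i, m + (-1) ^+ a.2) :: t' else (a.1, (-1) ^+ a.2) :: t
  else [:: (a.1, (-1) ^+ a.2)].

Definition syllables n (g : FreeGroup n) : seq ('I_n * int) :=
  foldr (@syllable_cons n) [::] (word g).

Definition zpow (G : groupType) (x : G) (m : int) : G :=
  match m with Posz k => (x ^+ k)%g | Negz k => (x ^- k.+1)%g end.

Definition power_normal_form n (s : seq ('I_n * int)) : bool :=
  all (fun p => p.2 != 0) s && sorted (fun p q => p.1 != q.1) s.

Definition Rolli (R : realType) n (lambda : 'I_n -> int -> R)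
    (g : FreeGroup n) : R :=
  \sum_(p <- syllables g) lambda p.1 p.2.

Definition Rolli_param (R : realType) n (lambda : 'I_n -> int -> R) : Prop :=
  forall i, (sup_norm (lambda i) < +oo)%E /\
            forall m, lambda i (- m) = - lambda i m.

Definition Rolli_norm (R : realType) n (lambda : 'I_n -> int -> R) : \bar R :=
  (\big[Order.max/0]_(i < n) sup_norm (lambda i))%E.

Definition spell n (s : seq ('I_n * int)) : seq (letter n) :=
  flatten [seq nseq `|p.2|%N (p.1, p.2 < 0) | p <- s].

Lemma word_gen_pow n (i : 'I_n) k : word (gen i ^+ k)%g = nseq k (i, false).
Proof.
elim: k => [|k IH]; first by [].
rewrite expgS wordM IH /=; case: k {IH} => [|k] //=.
by rewrite /invl /= xpair_eqE andbF.
Qed.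

Lemma word_zpow n (i : 'I_n) (m : int) :
  word (zpow (gen i) m) = nseq `|m|%N (i, m < 0).
Proof.
case: m => k; first exact: word_gen_pow.
transitivity (invw (word (gen i ^+ k.+1)%g)); first by [].
by rewrite word_gen_pow /invw map_nseq rev_nseq.
Qed.

Lemma word_syllables_prod n (s : seq ('I_n * int)) : power_normal_form s ->
  word (\prod_(p <- s) zpow (gen p.1) p.2)%g = spell s.
Proof.
elim: s => [|[i m] s IH]; first by rewrite big_nil.
rewrite big_cons /power_normal_form /= => /andP[/andP[m0 s0] ps].
have {}IH : word (\prod_(p <- s) zpow (gen p.1) p.2)%g = spell s.
  by apply: IH; rewrite /power_normal_form s0 (path_sorted ps).
rewrite -[RHS]/(nseq `|m|%N (i, m < 0) ++ spell s) -IH -word_zpow.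
apply/wordM_reduced; rewrite word_zpow.
have := word_reduced (\prod_(p <- s) zpow (gen p.1) p.2)%g; rewrite IH => rs.
elim: `|m|%N => [|k IHk] //=; rewrite /reduced /=.
case: k IHk => [|k] IHk /=; last by rewrite [X in X && _]negbT //; rewrite xpair_eqE andbC; case: (m < 0).
case: s s0 ps rs {IH IHk} => [|[j l] s] //= /andP[l0 _] /andP[ij _].
rewrite /spell /=; case: (absz l) (absz_eq0 l) => [|k] /=.
  by rewrite (negbTE l0).
by move=> _ ->; rewrite andbT xpair_eqE /= eq_sym (negbTE ij).
Qed.

Lemma syllables_spell n (s : seq ('I_n * int)) : power_normal_form s ->
  foldr (@syllable_cons n) [::] (spell s) = s.
Proof.
elim: s => [|[i m] s IH] //; rewrite /power_normal_form /= => /andP[/andP[m0 s0] ps].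
rewrite /spell /= foldr_cat -/(spell s) IH; last first.
  by rewrite /power_normal_form s0 (path_sorted ps).
have E k b : foldr (@syllable_cons n) s (nseq k.+1 (i, b)) =
    (i, (-1) ^+ b *+ k.+1) :: s.
  elim: k => [|k IHk]; last first.
    transitivity (syllable_cons (i, b)
      (foldr (@syllable_cons n) s (nseq k.+1 (i, b)))); first by [].
    by rewrite IHk /= eqxx -mulrSr.
  by case: s s0 ps {IH} => [|[j l] s] //= _ /andP[ij _]; rewrite eq_sym (negbTE ij).
have -> : nseq `|m|%N (i, m < 0) = nseq (`|m|%N.-1).+1 (i, m < 0).
  by rewrite prednK // absz_gt0.
rewrite E; congr ((_, _) :: _).
by case: m m0 {ps} => [[|k]|k] //= _; rewrite ?NegzE ?expr1 ?mulNrn; lia.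
Qed.

Lemma spell_syllables n (w : seq (letter n)) : reduced w ->
  power_normal_form (foldr (@syllable_cons n) [::] w) /\
  spell (foldr (@syllable_cons n) [::] w) = w.
Proof.
elim: w => [|[i b] w IH] // rw; have [] := IH (reduced_behead rw).
rewrite [foldr _ _ (_ :: _)]/=.
case: (foldr _ _ w) => [|[j m] t] /=.
  by move=> _ <-; case: b {rw}.
rewrite /power_normal_form /= => /andP[/andP[m0 t0] pt] e.
case: eqP => [ji|/eqP ji]; last first.
  rewrite /= m0 t0 /= pt [i == j]eq_sym ji /= /spell /= -[in RHS]e.
  by split; case: b {rw}.
have mb : (m < 0) = b.
  move: rw; rewrite -e /spell /= ji; case: m m0 {e pt} => [[|k]|k] // _ /=;
  by rewrite xpair_eqE eqxx /=; case: b.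
subst j; rewrite /= t0 -[in RHS]e /spell /=.
have [-> -> ->] : [/\ m + (-1) ^+ b != 0, absz (m + (-1) ^+ b) = `|m|%N.+1
                    & (m + (-1) ^+ b < 0) = b].
  by case: b mb {rw} => mb; rewrite ?expr1 ?expr0; split; lia.
by rewrite mb; split => //; case: t pt {t0 e} => [|[]].
Qed.

Lemma syllablesP n (g : FreeGroup n) (s : seq ('I_n * int)) :
  (power_normal_form s /\ g = \prod_(p <- s) zpow (gen p.1) p.2)%g <->
  s = syllables g.
Proof.
split=> [[ns ->]|->].
  by rewrite /syllables word_syllables_prod // syllables_spell.
have [ns e] := spell_syllables (word_reduced g).
by split=> //; apply/val_inj; rewrite /= word_syllables_prod.
Qed.

(** * Weighted sums of big Brooks quasimorphisms *)

(* The sum is locally finite by [finite_Brooks]. *)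
Definition psi_beta (R : realType) n (beta : FreeGroup n -> R)
    (g : FreeGroup n) : R :=
  \sum_(w \in [set w | w <> 1%g]) beta w * Brooks R w g.

Definition Brooks_weight (R : realType) n (beta : FreeGroup n -> R) : \bar R :=
  (\esum_(w in [set w | w <> 1%g])
     (((size (word w))%:R * `|beta w|)%:E * defect (Brooks R w)))%E.

(* Main.v *)
(* For a word with pieces marked along it, let E f g be the sum, over the marked
   pieces u of g = x u y, of the weight of u times (f (u y) + f y) / 2. With
   omega := delta^1 psi and eta(g, h) := E (omega (_, h)) g, the cocycle identity
   for omega turns p := phi \cup omega + delta^2 eta into
     p(g, h, i) = E (f (_ h)) g + E f h - E f (g h)  where f := omega (_, i).
   Write g = a b, h = b^-1 c and g h = a c as reduced products. The pieces inside
   a and c cancel between g, h and g h; those inside b cancel against their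
   inverses in b^-1, which see the same average of f. Only the pieces meeting one
   of the three cutting points survive: there is at most one per cut for an
   independent family, and at most three for powers of generators. So p is a
   bounded primitive of delta^1 phi \cup omega, for every quasimorphism psi, and
   its norm is controlled by the weights and D(psi) <= sum |beta_w| D(H_w). *)
Require Import Defs.
From mathcomp Require Import all_boot all_order all_algebra all_fingroup.
From mathcomp Require Import all_classical all_reals all_analysis.
From mathcomp Require Import finmap ring lra zify.

Set Implicit Arguments.
Unset Strict Implicit.
Unset Printing Implicit Defensive.

Import Order.TTheory GRing.Theory Num.Theory.
Import numFieldNormedType.Exports.

Local Open Scope classical_set_scope.
Local Open Scope ring_scope.

(** * Cancellation in products of reduced words *)

Section Words.
Variable n : nat.
Local Notation F := (FreeGroup n).
Implicit Types (s t a b : seq (letter n)) (g h : F).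

(** Reduction of an arbitrary list of letters; being total, it is multiplicative for concatenation
    without any reducedness condition. *)
Definition fg_of s : F := MkFreeGroup (mulw_reduced s (isT : reduced (@nil (letter n)))).

Lemma word_fg_of s : reduced s -> word (fg_of s) = s.
Proof. exact: mulw0. Qed.

Lemma fg_of_word g : fg_of (word g) = g.
Proof. exact/val_inj/mulw0/word_reduced. Qed.

Lemma fg_of_nil : fg_of [::] = 1%g.
Proof. exact: val_inj. Qed.

Lemma fg_of_cat s t : fg_of (s ++ t) = (fg_of s * fg_of t)%g.
Proof.
apply/val_inj; rewrite /= -mulwA ?mulw_reduced //=.
by rewrite /mulw foldr_cat.
Qed.

Lemma fg_of_invw s : fg_of (invw s) = (fg_of s)^-1%g.
Proof.
elim: s => [|x s IH]; first by rewrite fg_of_nil invg1 -fg_of_nil.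
rewrite /invw /= rev_cons -cats1 -/(invw s) fg_of_cat IH -[x :: s]cat1s fg_of_cat invMg.
by congr (_ * _)%g; apply/val_inj.
Qed.

Lemma invw_cat s t : invw (s ++ t) = invw t ++ invw s.
Proof. by rewrite /invw map_cat rev_cat. Qed.

Lemma size_invw s : size (invw s) = size s.
Proof. by rewrite /invw size_rev size_map. Qed.

Lemma reduced_catl s t : reduced (s ++ t) -> reduced s.
Proof. by rewrite /reduced => /cat_sorted2[]. Qed.

Lemma reduced_catr s t : reduced (s ++ t) -> reduced t.
Proof. by rewrite /reduced => /cat_sorted2[]. Qed.

(** Induction on [s]: a new letter [x] goes in front of [a], unless [a] is empty and [c] starts with
    the inverse of [x]; then [x] joins the cancelled part [b]. *)
Lemma mulw_cancel s t : reduced s -> exists a b c,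
  [/\ s = a ++ b, t = invw b ++ c & mulw s t = a ++ c].
Proof.
elim: s => [|x s IH] rs; first by exists [::], [::], t.
have [a [b [c [es et e]]]] := IH (reduced_behead rs).
rewrite /= -/(mulw s t) e; case: a es e => [|y a] es e.
  case: c et e => [|y c] et e /=.
    by exists [:: x], b, [::]; rewrite es.
  case: eqP => yx.
    exists [::], (x :: b), c; rewrite es; split => //.
    by rewrite et /invw /= rev_cons cat_rcons yx.
  by exists [:: x], b, (y :: c); rewrite es.
exists (x :: y :: a), b, c; rewrite es; split => //=.
by move: rs; rewrite es /reduced /= => /andP[/negbTE ->].
Qed.

Lemma fg_cancel g h : exists a b c : F,
  [/\ g = (a * b)%g /\ h = (b^-1 * c)%g, reduced (word a ++ word b),
      reduced (word b^-1%g ++ word c) & reduced (word a ++ word c)].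
Proof.
have [a [b [c [eg eh e]]]] := mulw_cancel (word h) (word_reduced g).
have rg : reduced (a ++ b) by rewrite -eg word_reduced.
have rh : reduced (invw b ++ c) by rewrite -eh word_reduced.
have rgh : reduced (a ++ c) by rewrite -e -wordM word_reduced.
have ra := word_fg_of (reduced_catl rg).
have rb := word_fg_of (reduced_catr rg).
have rc := word_fg_of (reduced_catr rh).
exists (fg_of a), (fg_of b), (fg_of c).
by rewrite -fg_of_cat -fg_of_invw -fg_of_cat -eg -eh !fg_of_word ra rb rc
  word_fg_of // invw_reduced // -rb word_reduced.
Qed.

End Words.

(** * Functionals that are additive, up to a bounded error, on reduced products *)

Section CutAdditive.
Variables (R : realType) (n : nat).
Local Notation F := (FreeGroup n).

(** In both applications [E f g] sums the marked pieces of [g] tested against [f], and [E (fun=> 1)]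
    is the quasimorphism itself. The combination [f - f' + c] is the shape of the cocycle identity
    used later; the second clause pairs each piece with its inverse; in the third, [C] measures the
    pieces disturbed by one cut. *)
Definition cut_additive (C : R) (E : (F -> R) -> F -> R) : Prop :=
  [/\ forall f f' c g,
        E (fun z => f z - f' z + c) g = E f g - E f' g + c * E (fun=> 1) g,
      forall f g, E (fun z => f (z * g^-1)%g) g = - E f g^-1%g &
      forall f D a b, (forall z, `|f z| <= D) -> reduced (word a ++ word b) ->
        `|E f (a * b)%g - E (fun z => f (z * b)%g) a - E f b| <= C * D].

(** One cut in each of g = a b, h = b^-1 c and g h = a c gives the factor 3. The terms of [a] and
    [c] occur twice with opposite signs, and the term of [b] cancels that of [b^-1] by the inversion
    clause. *)
Lemma cut_additive_triangle C E f D g h : cut_additive C E ->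
  (forall z, `|f z| <= D) ->
  `|E (fun z => f (z * h)%g) g + E f h - E f (g * h)%g| <= 3 * C * D.
Proof.
move=> [_ EV Ecat] fD.
have [a [b [c [[-> ->] rab rbc rac]]]] := fg_cancel g h.
have fhD z : `|f (z * (b^-1 * c))%g| <= D by [].
have := Ecat _ _ _ _ fhD rab.
have := Ecat _ _ _ _ fD rbc.
have := Ecat _ _ _ _ fD rac.
have -> : (a * b * (b^-1 * c) = a * c)%g by rewrite mulgA mulgK.
have -> : (fun z : F => f (z * b * (b^-1 * c))%g) = (fun z => f (z * c)%g).
  by apply/funext => z; rewrite mulgA mulgK.
have -> : (fun z : F => f (z * (b^-1 * c))%g) =
    (fun z => (fun y => f (y * c)%g) (z * b^-1)%g).
  by apply/funext => z; rewrite mulgA.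
rewrite (EV (fun y => f (y * c)%g) b) !ler_norml; lra.
Qed.

End CutAdditive.

(** * Extended sup norms versus real bounds *)

Section SupNorm.
Variables (R : realType) (T : Type).
Implicit Type f : T -> R.

Lemma sup_norm_le f B : (forall x, `|f x| <= B) -> (sup_norm f <= B%:E)%E.
Proof. by move=> fB; apply: ge_ereal_sup => _ [x _ <-]; rewrite lee_fin. Qed.

Lemma sup_norm_ge f x : (`|f x|%:E <= sup_norm f)%E.
Proof. by apply: ereal_sup_ubound; exists x. Qed.

Lemma le_fine_sup_norm f x : (sup_norm f < +oo)%E -> `|f x| <= fine (sup_norm f).
Proof.
move=> foo; rewrite -lee_fin fineK ?sup_norm_ge // ge0_fin_numE //.
exact: le_trans (sup_norm_ge f x).
Qed.

Lemma sup_norm_lty f B : (forall x, `|f x| <= B) -> (sup_norm f < +oo)%E.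
Proof. by move/sup_norm_le/le_lt_trans; apply; apply: ltry. Qed.

End SupNorm.

(** * Explicit low-degree coboundaries and vanishing of a cup product of classes *)

Section Cohomology.
Variables (R : realType) (G : groupType).
Implicit Types phi psi : G -> R.

Let o30 : 'I_3 := @Ordinal 3 0 isT.
Let o31 : 'I_3 := @Ordinal 3 1 isT.
Let o32 : 'I_3 := @Ordinal 3 2 isT.

Definition cochain3 (P : G -> G -> G -> R) : cochain R G 3 :=
  fun t => P (tnth t o30) (tnth t o31) (tnth t o32).

Lemma delta1_tnth phi (t : 2.-tuple G) :
  delta1 phi t = phi (tnth t ord0) + phi (tnth t ord_max)
                 - phi (tnth t ord0 * tnth t ord_max)%g.
Proof.
rewrite -delta1E; congr (delta1 phi _); apply: eq_from_tnth => i.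
by rewrite [RHS](tnth_nth 1%g) /=; case: i => [[|[|//]]] i2 /=;
  congr (tnth t _); apply: val_inj.
Qed.

Lemma coboundary_cochain3 P (g : 4.-tuple G) : let x i := nth 1%g g i in
  coboundary (cochain3 P) g =
    P (x 1%N) (x 2%N) (x 3%N) - P (x 0%N * x 1%N)%g (x 2%N) (x 3%N)
    + P (x 0%N) (x 1%N * x 2%N)%g (x 3%N) - P (x 0%N) (x 1%N) (x 2%N * x 3%N)%g
    + P (x 0%N) (x 1%N) (x 2%N).
Proof.
rewrite /coboundary /cochain3 !big_ord_recl big_ord0 !tnth_mktuple.
rewrite !(tnth_nth 1%g) /= !nth_behead /bump /= !exprS !expr0.
ring.
Qed.

(* [eta] is arbitrary: it will be chosen to make this primitive bounded. *)
Lemma coboundary_cup_delta1 phi psi (eta : G -> G -> R) :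
  coboundary (cochain3 (fun a b c => phi a * (psi b + psi c - psi (b * c)%g)
    + eta b c - eta (a * b)%g c + eta a (b * c)%g - eta a b))
  = cup (delta1 phi) (delta1 psi).
Proof.
apply/funext => g; rewrite coboundary_cochain3 /cup !delta1_tnth !tnth_mktuple.
by rewrite !(tnth_nth 1%g) /= !mulgA; ring.
Qed.

Lemma bounded_cochainsB m (f f' : cochain R G m) :
  bounded_cochains f -> bounded_cochains f' -> bounded_cochains (f \- f').
Proof.
move=> fb fb'; apply: (@sup_norm_lty _ _ _ (fine (sup_norm f) + fine (sup_norm f'))).
by move=> x; rewrite (le_trans (ler_normB _ _)) // lerD // le_fine_sup_norm.
Qed.

Lemma coboundaryB m (f f' : cochain R G m) :
  coboundary (f \- f') = coboundary f \- coboundary f'.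
Proof.
apply/funext => g; rewrite /coboundary /=.
under eq_bigr do rewrite mulrBr.
by rewrite sumrB mulrBr; ring.
Qed.

Lemma coboundary0 m : coboundary (fun=> 0 : R) = (fun=> 0) :> cochain R G m.+1.
Proof.
apply/funext => g; rewrite /coboundary mulr0 big1 ?addr0 // => i _.
by rewrite mulr0.
Qed.

Lemma coboundary1 (b : cochain R G 1) :
  coboundary b = delta1 (fun x => b [tuple x]).
Proof.
rewrite /delta1; congr (coboundary _); apply/funext => t.
by congr b; apply: eq_from_tnth => i; rewrite (ord1 i) [RHS](tnth_nth 1%g).
Qed.

Lemma delta1D phi psi : delta1 (phi \+ psi) = delta1 phi \+ delta1 psi.
Proof. by apply/funext => t /=; rewrite !delta1_tnth /=; ring. Qed.

Lemma coboundary_delta1 phi : coboundary (delta1 phi) = (fun=> 0).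
Proof.
apply/funext => g; rewrite /coboundary !big_ord_recl big_ord0 !delta1_tnth.
rewrite !tnth_mktuple.
case/tupleP: g => a g; case/tupleP: g => b g; case/tupleP: g => c g.
rewrite tuple0 !(tnth_nth 1%g) /= !mulgA /bump /= !exprS !expr0.
ring.
Qed.

Lemma quasimorphismP phi D : (forall g h, `|phi g + phi h - phi (g * h)%g| <= D) ->
  quasimorphism phi.
Proof. by move=> H; apply: (@sup_norm_lty _ _ _ D) => t; rewrite delta1_tnth. Qed.

Lemma quasimorphism_le phi g h : quasimorphism phi ->
  `|phi g + phi h - phi (g * h)%g| <= fine (defect phi).
Proof. by move=> q; rewrite -delta1E; apply: le_fine_sup_norm. Qed.

Lemma defect_ge0 phi : (0 <= defect phi)%E.
Proof. exact: le_trans (sup_norm_ge _ [tuple 1%g; 1%g]). Qed.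

Lemma Hb_class_delta1 phi : quasimorphism phi ->
  Hb_class (delta1 phi) (delta1 phi).
Proof.
move=> q; split; first by split => //; apply: coboundary_delta1.
exists (fun=> 0); first by apply: (@sup_norm_lty _ _ _ 0) => x; rewrite normr0.
by rewrite coboundary0; apply/funext => t /=; rewrite subrr.
Qed.

(** [Hb_cup] ranges over all representatives, hence the assumption on every [psi']: a change of the
    second representative is absorbed into [psi'], and a change of the first by a bounded [b] adds
    the coboundary of the bounded product of [b] with [delta1 psi']. *)
Lemma Hb_cup_eq0 phi psi : quasimorphism phi ->  quasimorphism psi ->
  (forall psi', quasimorphism psi' ->
     bounded_coboundaries (cup (delta1 phi) (delta1 psi'))) ->
  Hb_cup (Hb_class (delta1 phi)) (Hb_class (delta1 psi)) = @Hb_zero R G 4.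
Proof.
move=> qphi qpsi H; apply/seteqP; split => h.
  move=> [f [f' [[_ [b bb ef]] [[_ _] [b' bb' ef']] [hz [d bd ed]]]]].
  split => //.
  have {}ef : f = delta1 phi \+ delta1 (fun x => b [tuple x]).
    by rewrite -coboundary1 ef; apply/funext => t /=; rewrite addrC subrK.
  (* Adding the bounded [b'] raises the defect by at most three times its norm, so the assumption
     [H] covers [psi']. *)
  pose psi' := psi \+ (fun x => b' [tuple x]).
  have {}ef' : f' = delta1 psi'.
    by rewrite delta1D -coboundary1 ef'; apply/funext => t /=; rewrite addrC subrK.
  have qpsi' : quasimorphism psi'.
    apply: (@quasimorphismP _ (fine (defect psi) + 3 * fine (sup_norm b'))) => x y.
    have := quasimorphism_le x y qpsi.
    have := le_fine_sup_norm [tuple x] bb'.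
    have := le_fine_sup_norm [tuple y] bb'.
    have := le_fine_sup_norm [tuple (x * y)%g] bb'.
    by rewrite /psi' /= !ler_norml; lra.
  have [p bp ep] := H _ qpsi'.
  (* The product of [b] and [delta1 psi']; the zeros keep the form of [coboundary_cup_delta1] with
     [eta] = 0. *)
  pose q := cochain3 (fun a b0 c => b [tuple a] *
    (psi' b0 + psi' c - psi' (b0 * c)%g) + 0 - 0 + 0 - 0).
  have eq : coboundary q = cup (delta1 (fun x => b [tuple x])) (delta1 psi').
    exact: (coboundary_cup_delta1 _ psi' (fun _ _ => 0)).
  have bq : bounded_cochains q.
    apply: (@sup_norm_lty _ _ _ (fine (sup_norm b) * fine (defect psi'))) => t.
    rewrite /q /cochain3 !(addr0, subr0) normrM ler_pM //.
      exact: le_fine_sup_norm.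
    exact: quasimorphism_le.
  have b0 : @bounded_cochains R G 3 (fun=> 0).
    by apply: (@sup_norm_lty _ _ _ 0) => x; rewrite normr0.
  (* This is d + p + q, written with differences only so that [bounded_cochainsB] and [coboundaryB]
     apply. *)
  clearbody q; exists (d \- (((fun=> 0) \- p) \- q)).
    by do 3![apply: bounded_cochainsB => //].
  rewrite !coboundaryB coboundary0 ed ep eq ef ef'.
  by apply/funext => t /=; rewrite /cup /=; ring.
move=> [hz [d bd ed]].
exists (delta1 phi), (delta1 psi); split; [exact: Hb_class_delta1..|].
split => //; have [p bp ep] := H _ qpsi.
exists (d \- p); first exact: bounded_cochainsB.
by rewrite coboundaryB ep ed; apply/funext => t /=; rewrite subr0.
Qed.

End Cohomology.

(** * A bounded primitive from a cut-additive functional *)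

Section CupVanishing.
Variables (R : realType) (n : nat).
Local Notation F := (FreeGroup n).
Variables (C : R) (E : (F -> R) -> F -> R).
Hypothesis EC : cut_additive C E.

(** The cocycle identity om(z b, c) = om(z, b c) - om(z, b) + om(b, c) and the first clause of
    [cut_additive] rewrite the primitive at (a, b, c) as E(om(_ b, c))(a) + E(om(_, c))(b) - E(om(_,
    c))(a b), which the triangle estimate bounds. *)
Lemma cut_additive_primitive (psi : F -> R) (D : R) :
  (forall g h, `|psi g + psi h - psi (g * h)%g| <= D) ->
  exists2 p, coboundary p = cup (delta1 (E (fun=> 1))) (delta1 psi) &
    forall t, `|p t| <= 3 * C * D.
Proof.
move=> psiD; pose om z h := psi z + psi h - psi (z * h)%g.
pose eta g h := E (om^~ h) g.
eexists; first exact: (coboundary_cup_delta1 _ _ eta).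
move=> t; rewrite /cochain3; move: (tnth t _) (tnth t _) (tnth t _) => c b a.
have [EL _ _] := EC.
have := cut_additive_triangle (f := om^~ c) a b EC (fun z => psiD z c).
have -> : (fun z => om (z * b)%g c) =
    (fun z => om z (b * c)%g - om z b + om b c).
  by apply/funext => z; rewrite /om mulgA; ring.
rewrite EL -/(eta a (b * c)%g) -/(eta a b) -/(eta b c) -/(eta (a * b)%g c).
rewrite -/(om b c); congr (`| _ | <= _); ring.
Qed.

Lemma cut_additive_cup (psi : F -> R) : quasimorphism psi ->
  [/\ quasimorphism (E (fun=> 1)),
      Hb_cup (Hb_class (delta1 (E (fun=> 1)))) (Hb_class (delta1 psi))
        = @Hb_zero R F 4
    & exists p : cochain R F 3,
        is_primitive (cup (delta1 (E (fun=> 1))) (delta1 psi)) p /\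
        (sup_norm p <= (3 * C * fine (defect psi))%:E)%E].
Proof.
move=> qpsi.
have qE : quasimorphism (E (fun=> 1)).
  apply: (@quasimorphismP _ _ _ (3 * C * 1)) => g h.
  by apply: (cut_additive_triangle g h EC (f := fun=> 1)) => z; rewrite normr1.
have prim psi' : quasimorphism psi' -> exists p : cochain R F 3,
    is_primitive (cup (delta1 (E (fun=> 1))) (delta1 psi')) p /\
    (sup_norm p <= (3 * C * fine (defect psi'))%:E)%E.
  move=> q; have [p ep bp] := cut_additive_primitive
    (fun g h => quasimorphism_le g h q).
  exists p; split; last exact: sup_norm_le.
  by split => //; apply: sup_norm_lty bp.
split => //; last exact: prim.
by apply: Hb_cup_eq0 => // psi' /prim[p [[bp ep] _]]; exists p.
Qed.

End CupVanishing.

(** * Sums over all subwords, and independent families at a cut *)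

Section OccurrenceSums.
Variables (R : realType) (n : nat).
Local Notation F := (FreeGroup n).
Implicit Types (k f : F -> R) (a b s : seq (letter n)).

(** The pieces starting at the first letter of [s]; the shift [q.+1] leaves out the empty piece. *)
Definition prefix_sum k f s : R :=
  \sum_(0 <= q < size s) k (fg_of (take q.+1 s))
    * ((f (fg_of s) + f (fg_of (drop q.+1 s))) / 2).

(* Sum over all ways of writing the word [s] as [x u y] with [u] nonempty. The
   average of [f (u y)] and [f y] is what makes [occ_sum_invw] hold. *)
Fixpoint occ_sum k f s : R :=
  if s is x :: s' then prefix_sum k f s + occ_sum k f s' else 0.

(* The part of [occ_sum k f (a ++ b)] where [u] meets both [a] and [b]. *)
Definition straddle k f a b : R :=
  \sum_(0 <= p < size a) \sum_(0 <= q < size b)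
    k (fg_of (drop p a ++ take q.+1 b))
      * ((f (fg_of (drop p a ++ b)) + f (fg_of (drop q.+1 b))) / 2).

Lemma occ_sum_linear k f f' c s :
  occ_sum k (fun z => f z - f' z + c) s
  = occ_sum k f s - occ_sum k f' s + c * occ_sum k (fun=> 1) s.
Proof.
elim: s => [|x s IH] /=; first by ring.
have -> : prefix_sum k (fun z => f z - f' z + c) (x :: s) =
    prefix_sum k f (x :: s) - prefix_sum k f' (x :: s)
    + c * prefix_sum k (fun=> 1) (x :: s).
  rewrite /prefix_sum mulr_sumr -sumrB -big_split /=; apply: eq_bigr => q _.
  by field.
rewrite IH; ring.
Qed.

Lemma occ_sum_sum (I : Type) (r : seq I) (c : I -> R) (k : I -> F -> R) f s :
  occ_sum (fun w => \sum_(i <- r) c i * k i w) f s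
  = \sum_(i <- r) c i * occ_sum (k i) f s.
Proof.
elim: s => [|x s IH] /=; first by rewrite big1 // => i _; rewrite mulr0.
under [RHS]eq_bigr do rewrite mulrDr mulr_sumr.
rewrite IH big_split exchange_big /=; congr (_ + _).
apply: eq_bigr => q _; rewrite mulr_suml; apply: eq_bigr => i _.
by rewrite -mulrA.
Qed.

Lemma straddle_sum (I : Type) (r : seq I) (k : I -> F -> R) f a b :
  straddle (fun w => \sum_(i <- r) k i w) f a b
  = \sum_(i <- r) straddle (k i) f a b.
Proof.
rewrite /straddle [RHS]exchange_big /=; apply: eq_bigr => p _.
rewrite [RHS]exchange_big /=; apply: eq_bigr => q _.
by rewrite mulr_suml.
Qed.

(** A piece lies inside [a], where its tail is prolonged by [b], or inside [b], or it meets both. *)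
Lemma occ_sum_cat k f a b :
  occ_sum k f (a ++ b)
  = occ_sum k (fun z => f (z * fg_of b)%g) a + occ_sum k f b + straddle k f a b.
Proof.
elim: a => [|x a IH]; first by rewrite /straddle big_geq //= add0r addr0.
(* The pieces that start at the new letter [x] and end in [b]: the row [p] = 0 of the double sum. *)
pose B := \sum_(0 <= q < size b) k (fg_of (x :: a ++ take q.+1 b))
  * ((f (fg_of (x :: a ++ b)) + f (fg_of (drop q.+1 b))) / 2).
have -> : straddle k f (x :: a) b = B + straddle k f a b.
  by rewrite /straddle big_nat_recl.
rewrite cat_cons /= IH.
have -> : prefix_sum k f (x :: (a ++ b)) =
    prefix_sum k (fun z => f (z * fg_of b)%g) (x :: a) + B.
  rewrite /prefix_sum -cat_cons size_cat (@big_cat_nat _ _ _ (size (x :: a))) //=;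
    last by rewrite leq_addr.
  rewrite -{2}[(size a).+1]add0n big_addn addKn; congr (_ + _).
    apply: eq_big_nat => q /andP[_ qa]; rewrite -!fg_of_cat takel_cat //.
    (* The boundary case [q] = |a|: the piece ends exactly at the cut and its tail is [b]. *)
    rewrite drop_cat; case: ltnP => // aq.
    have -> : q = size a by apply/eqP; rewrite eqn_leq aq andbT.
    by rewrite subnn drop0 drop_size.
  apply: eq_big_nat => q /andP[_ qb].
  by rewrite addnS -addSn take_cat drop_cat ltnNge leq_addl /= addnK.
ring.
Qed.

Lemma drop_invw i s : (i <= size s)%N ->
  drop (size s - i) (invw s) = invw (take i s).
Proof.
move=> si; rewrite -{2}(cat_take_drop i s) invw_cat drop_size_cat //.
by rewrite size_invw size_drop.
Qed.

(** Writing s = x u y, the translated [f] is evaluated at x^-1 and u^-1 x^-1, the same two points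
    that the piece u^-1 of s^-1 = y^-1 u^-1 x^-1 sees; averaging makes their order irrelevant. *)
Lemma occ_sum_invw k f s : (forall w, k w^-1%g = - k w) ->
  occ_sum k (fun z => f (z * (fg_of s)^-1)%g) s = - occ_sum k f (invw s).
Proof.
move=> kV; elim: s f => [|x s IH] f; first by rewrite oppr0.
have -> : invw (x :: s) = invw s ++ [:: invl x] by rewrite -[x :: s]cat1s invw_cat.
have xV : (fg_of [:: x])^-1%g = fg_of [:: invl x] by rewrite -fg_of_invw.
rewrite occ_sum_cat /= addr0.
have -> : occ_sum k (fun z => f (z * (fg_of (x :: s))^-1)%g) s =
    - occ_sum k (fun z => f (z * fg_of [:: invl x])%g) (invw s).
  rewrite -IH; congr (occ_sum k _ s); apply/funext => z.
  by rewrite -cat1s fg_of_cat invgM mulgA xV.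
(* Pieces starting with [x] are the inverses of those ending at the last letter of the inverse word:
   that letter alone, or a piece straddling the cut before it. *)
suff -> : prefix_sum k (fun z => f (z * (fg_of (x :: s))^-1)%g) (x :: s) =
    - prefix_sum k f [:: invl x] - straddle k f (invw s) [:: invl x] by ring.
(* Longer prefixes correspond to earlier starts in the inverse, hence the reversed index. *)
rewrite /straddle size_invw big_nat_rev /= add0n.
rewrite /prefix_sum /= big_nat_recl // big_nat1 -sumrN /=.
rewrite mulgV fg_of_nil take0 drop0 -xV kV.
have cancel u v : (fg_of v * (fg_of (u ++ v))^-1 = (fg_of u)^-1)%g.
  by rewrite fg_of_cat invgM mulgA mulgV mul1g.
congr (_ + _).
  by rewrite -[x :: s]cat1s cancel; ring.
apply: eq_big_nat => q /andP[_ qs]; rewrite big_nat1 /=.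
have -> : drop (size s - q.+1) (invw s) ++ [:: invl x] = invw (x :: take q.+1 s).
  by rewrite drop_invw // -[x :: _]cat1s invw_cat.
rewrite fg_of_invw kV.
have -> : (fg_of (drop q.+1 s) * (fg_of (x :: s))^-1 =
    (fg_of (x :: take q.+1 s))^-1)%g.
  by rewrite -{2}(cat_take_drop q.+1 s) -cat_cons cancel.
ring.
Qed.

Lemma norm_sum_le1 (T : finType) (X : T -> R) (B : R) : 0 <= B ->
  (forall t, `|X t| <= B) ->
  (forall t t', X t != 0 -> X t' != 0 -> t = t') -> `|\sum_t X t| <= B.
Proof.
move=> B0 XB uniqX; case: (pickP (fun t => X t != 0)) => [t Xt|X0].
  rewrite (bigD1 t) //= big1 ?addr0 // => t' tt'; apply/eqP.
  by apply: contraNT tt' => Xt'; rewrite (uniqX t' t).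
by rewrite big1 ?normr0 // => t _; apply/eqP; have /negbFE := X0 t.
Qed.

(** Two pieces across the same cut both contain the letters next to it. If they occupy different
    positions, one properly contains the other or they cross in a nonempty common part; either way
    they overlap, even when they are equal as words. *)
Lemma overlap_straddling (I : set F) a b p q p' q' :
  independent I -> reduced (a ++ b) ->
  (p < size a)%N -> (q < size b)%N -> (p' < size a)%N -> (q' < size b)%N ->
  I (fg_of (drop p a ++ take q.+1 b)) -> I (fg_of (drop p' a ++ take q'.+1 b)) ->
  (p, q) = (p', q').
Proof.
move=> indI rab.
have rsub x y : reduced (drop x a ++ take y b).
  move: rab; rewrite -{1}(cat_take_drop y b) catA => /reduced_catl.
  by rewrite -{1}(cat_take_drop x a) -catA => /reduced_catr.
have ne s : reduced s -> s != [::] -> fg_of s <> 1%g.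
  by move=> rs s0 /(congr1 (@word n)); rewrite word_fg_of // => s1; rewrite s1 in s0.
have contained x y x' y' : (x <= x' < size a)%N -> (y' <= y < size b)%N ->
    (x, y) != (x', y') ->
    overlap (fg_of (drop x' a ++ take y'.+1 b)) (fg_of (drop x a ++ take y.+1 b)).
  move=> /andP[xx x'a] /andP[yy yb] xy; apply: Or32.
  have ea : drop x a = take (x' - x) (drop x a) ++ drop x' a.
    by rewrite -{1}(cat_take_drop (x' - x) (drop x a)) drop_drop subnK.
  have eb : take y.+1 b = take y'.+1 b ++ take (y - y') (drop y'.+1 b).
    by rewrite -{1}(subnKC yy) -addSn takeD.
  have e : drop x a ++ take y.+1 b = take (x' - x) (drop x a) ++
     (drop x' a ++ take y'.+1 b) ++ take (y - y') (drop y'.+1 b).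
    by rewrite {1}ea eb !catA.
  have s1 : size (take (x' - x) (drop x a)) = (x' - x)%N.
    by rewrite size_takel // size_drop; lia.
  have s2 : size (take (y - y') (drop y'.+1 b)) = (y - y')%N.
    by rewrite size_takel // size_drop; lia.
  have := rsub x y.+1; rewrite e => r.
  split; last first.
    move=> /(congr1 (@word n))/(congr1 size); rewrite !word_fg_of //.
    rewrite !size_cat s1 s2 => ?.
    by move/eqP: xy; apply; congr (_, _); lia.
  exists (fg_of (take (x' - x) (drop x a))), (fg_of (take (y - y') (drop y'.+1 b))).
  rewrite !word_fg_of //.
  - by move: r; rewrite catA => /reduced_catr.
  - by move: r => /reduced_catl.
have crossing x y x' y' : (x < x' < size a)%N -> (y < y' < size b)%N ->
    overlap (fg_of (drop x a ++ take y.+1 b)) (fg_of (drop x' a ++ take y'.+1 b)).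
  move=> /andP[xx x'a] /andP[yy y'b]; apply: Or31.
  have ea : drop x a = take (x' - x) (drop x a) ++ drop x' a.
    by rewrite -{1}(cat_take_drop (x' - x) (drop x a)) drop_drop subnK // ltnW.
  have eb : take y'.+1 b = take y.+1 b ++ take (y' - y) (drop y.+1 b).
    by rewrite -{1}(subnKC (ltnW yy)) -addSn takeD.
  have e1 : drop x a ++ take y.+1 b =
      take (x' - x) (drop x a) ++ (drop x' a ++ take y.+1 b).
    by rewrite {1}ea !catA.
  have e2 : drop x' a ++ take y'.+1 b =
      (drop x' a ++ take y.+1 b) ++ take (y' - y) (drop y.+1 b).
    by rewrite {1}eb !catA.
  have s1 : size (take (x' - x) (drop x a)) = (x' - x)%N.
    by rewrite size_takel // size_drop; lia.
  have s2 : size (take (y' - y) (drop y.+1 b)) = (y' - y)%N.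
    by rewrite size_takel // size_drop; lia.
  have r1 := rsub x y.+1; have r2 := rsub x' y'.+1.
  have r3 := rsub x' y.+1.
  have r4 : reduced (take (x' - x) (drop x a)).
    by move: r1; rewrite e1 => /reduced_catl.
  have r5 : reduced (take (y' - y) (drop y.+1 b)).
    by move: r2; rewrite e2 => /reduced_catr.
  exists (fg_of (take (x' - x) (drop x a))), (fg_of (drop x' a ++ take y.+1 b)),
    (fg_of (take (y' - y) (drop y.+1 b))).
  split; [apply: ne => //..|left; rewrite !word_fg_of //].
  - by rewrite -size_eq0 s1; lia.
  - by rewrite -size_eq0 -lt0n size_cat size_drop addn_gt0 subn_gt0 x'a.
  - by rewrite -size_eq0 s2; lia.
move=> pa qb p'a q'b Iw Iw'; apply/eqP; apply/negPn/negP => pq.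
(* A larger [p] starts later and a larger [q] ends later: both strictly shifted the same way gives a
   crossing, all other cases a containment. *)
have [pp|pp] := leqP p p'; have [qq|qq] := leqP q q'.
- have [|pp'] := eqVneq p p'; last have [|qq'] := eqVneq q q'.
  + move=> e; apply: (indI _ _ Iw Iw').
    apply: contained => //; [by rewrite e leqnn|by rewrite qq|by rewrite eq_sym].
  + move=> e; apply: (indI _ _ Iw' Iw).
    apply: contained => //; [by rewrite pp|by rewrite e leqnn].
  + by apply: (indI _ _ Iw Iw'); apply: crossing; lia.
- by apply: (indI _ _ Iw' Iw); apply: contained => //; lia.
- by apply: (indI _ _ Iw Iw'); apply: contained; [lia|lia|rewrite eq_sym].
- by apply: (indI _ _ Iw' Iw); apply: crossing; lia.
Qed.

(** By [overlap_straddling] at most one term of the double sum is nonzero. *)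
Lemma straddle_independent (I : set F) k f a b M D :
  independent I -> supported_on k I -> reduced (a ++ b) ->
  (forall w, `|k w| <= M) -> (forall z, `|f z| <= D) ->
  `|straddle k f a b| <= M * D.
Proof.
move=> indI kI rab kM fD.
have M0 : 0 <= M by apply: le_trans (kM 1%g).
have D0 : 0 <= D by apply: le_trans (fD 1%g).
rewrite /straddle big_mkord; under eq_bigr do rewrite big_mkord.
rewrite pair_big /=; apply: norm_sum_le1; first exact: mulr_ge0.
  move=> [p q] /=; rewrite normrM ler_pM //.
  have := fD (fg_of (drop p a ++ b)); have := fD (fg_of (drop q.+1 b)).
  rewrite !ler_norml; lra.
move=> [p q] [p' q'] /=; rewrite !mulf_eq0 !negb_or.
move=> /andP[/kI Iw _] /andP[/kI Iw' _].
have [] := overlap_straddling indI rab (ltn_ord p) (ltn_ord q) (ltn_ord p')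
  (ltn_ord q') Iw Iw'.
by move=> /val_inj -> /val_inj ->.
Qed.

Lemma straddle_decomposition (alpha : F -> R) (al : nat -> F -> R) f a b D :
  ind_decomposition alpha al -> reduced (a ++ b) -> (forall z, `|f z| <= D) ->
  `|straddle alpha f a b| <= fine (\sum_(0 <= i <oo) sup_norm (al i))%E * D.
Proof.
move=> [alI al_fin al_cvg] rab fD.
have D0 : 0 <= D by apply: le_trans (fD 1%g).
have al0 i : (0 <= sup_norm (al i))%E by apply: le_trans (sup_norm_ge _ 1%g).
have al_lty i : (sup_norm (al i) < +oo)%E by have [I []] := alI i.
have T_fin : (\sum_(0 <= i <oo) sup_norm (al i))%E \is a fin_num.
  by rewrite ge0_fin_numE // nneseries_ge0.
(* For fixed [a] and [b] this is a finite linear expression in the weights, so pointwise convergence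
   is enough. *)
have str_cvg : straddle (fun w => series (fun i => al i w) N) f a b @[N --> \oo]
    --> straddle alpha f a b.
  apply: cvg_big => [|p _]; first exact: add_continuous.
  apply: cvg_big => [|q _]; first exact: add_continuous.
  by apply: cvgMr_tmp; apply: al_cvg.
apply: (cvgr_to_le (cvg_norm str_cvg)); apply: nearW => N.
rewrite /series /= straddle_sum (le_trans (ler_norm_sum _ _ _)) //.
have : \sum_(0 <= i < N) fine (sup_norm (al i)) <=
    fine (\sum_(0 <= i <oo) sup_norm (al i))%E.
  rewrite -lee_fin fineK // -sumEFin.
  under eq_bigr => i _ do rewrite fineK ?ge0_fin_numE //.
  exact: nneseries_lim_ge.
move=> /(ler_wpM2r D0); apply: le_trans; rewrite mulr_suml.
apply: ler_sum => i _; have [I [_ indI _ sI _]] := alI i.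
apply: straddle_independent indI sI rab _ fD => w.
exact: le_fine_sup_norm.
Qed.

Lemma SInd_fin_num (alpha : F -> R) : ell1_Ind alpha ->
  SInd alpha \is a fin_num /\ (0 <= SInd alpha)%E.
Proof.
move=> [_ _ [al0 dec0]].
have S0 : (0 <= SInd alpha)%E.
  apply: le_ereal_inf_tmp => _ [al _ <-]; apply: nneseries_ge0 => i _ _.
  exact: le_trans (sup_norm_ge (al i) 1%g).
split => //; rewrite ge0_fin_numE //; have [_ fin0 _] := dec0.
by apply: le_lt_trans fin0; apply: ereal_inf_lbound; exists al0.
Qed.

Lemma straddle_SInd (alpha : F -> R) f a b D :
  ell1_Ind alpha -> reduced (a ++ b) -> (forall z, `|f z| <= D) ->
  `|straddle alpha f a b| <= fine (SInd alpha) * D.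
Proof.
move=> al1 rab fD; have [S_fin _] := SInd_fin_num al1.
have D0 : 0 <= D by apply: le_trans (fD 1%g).
have pos (al : nat -> F -> R) : (0 <= \sum_(0 <= i <oo) sup_norm (al i))%E.
  by apply: nneseries_ge0 => i _ _; apply: le_trans (sup_norm_ge (al i) 1%g).
(* Passing to the infimum over decompositions divides by [D]; for [D] = 0 any one decomposition
   suffices. *)
have [D_eq0|D_neq0] := eqVneq D 0.
  have [_ _ [al dec]] := al1.
  by have := straddle_decomposition dec rab fD; rewrite D_eq0 !mulr0.
have Dpos : 0 < D by rewrite lt0r D_neq0.
rewrite -ler_pdivrMr // -lee_fin fineK //.
apply: le_ereal_inf_tmp => _ [al dec <-].
have [_ fin _] := dec; have := straddle_decomposition dec rab fD.
by rewrite -ler_pdivrMr // -lee_fin fineK // ge0_fin_numE.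
Qed.

Lemma occ_sum_cut_additive (alpha : F -> R) : ell1_Ind alpha ->
  cut_additive (fine (SInd alpha)) (fun f g => occ_sum alpha f (word g)).
Proof.
move=> al1; have [alt _ _] := al1; split.
- by move=> f f' c g; apply: occ_sum_linear.
- by move=> f g; rewrite -{1}[g]fg_of_word occ_sum_invw.
- move=> f D a b fD rab; have /wordM_reduced -> := rab.
  rewrite occ_sum_cat fg_of_word.
  rewrite (_ : _ - _ = straddle alpha f (word a) (word b)); last by ring.
  exact: straddle_SInd.
Qed.

End OccurrenceSums.

(** * Brooks quasimorphisms as occurrence sums *)

Section BrooksOccurrences.
Variables (R : realType) (n : nat).
Local Notation F := (FreeGroup n).
Implicit Types (w u g : F) (s : seq (letter n)).

Lemma eq_occ_sum (k k' f : F -> R) s : reduced s ->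
  (forall u, u <> 1%g -> (size u <= size s)%N -> k u = k' u) ->
  occ_sum k f s = occ_sum k' f s.
Proof.
elim: s => [//|x s IH] rs kk'; rewrite /= (IH (reduced_behead rs)); last first.
  by move=> u u1 us; apply: kk' => //; apply: leqW.
congr (_ + _); apply: eq_big_nat => q /andP[_ qs]; congr (_ * _).
have r : reduced (take q.+1 (x :: s)).
  by move: rs; rewrite -{1}(cat_take_drop q.+1 (x :: s)) => /reduced_catl.
apply: kk'; first by move/(congr1 (@word n)); rewrite word_fg_of.
by rewrite word_fg_of // size_take_min geq_minr.
Qed.

(** Only the prefix of length |w| can equal [w], so only the index |w| - 1 can contribute. *)
Lemma prefix_sum1 w s : w <> 1%g -> reduced s ->
  \sum_(0 <= q < size s) (fg_of (take q.+1 s) == w)%:R = (prefix w s)%:R :> R.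
Proof.
move=> w1 rs; have r q : reduced (take q s).
  by move: rs; rewrite -{1}(cat_take_drop q s) => /reduced_catl.
have szw : (0 < size w)%N.
  by rewrite lt0n size_eq0; apply/eqP => e; apply: w1; apply: val_inj.
have eqw q : (q < size s)%N ->
    (fg_of (take q.+1 s) == w) = prefix w s && (q == (size w).-1).
  move=> qs; rewrite prefixE; apply/eqP/andP => [<-|[/eqP e /eqP ->]].
    by rewrite word_fg_of // size_takel.
  by rewrite prednK // e fg_of_word.
under eq_big_nat => q /andP[_ qs] do rewrite eqw //.
case: (boolP (prefix w s)) => [pw|_]; last by rewrite big1.
have ws : ((size w).-1 < size s)%N.
  by rewrite prednK //; move: pw => /prefixP[t ->]; rewrite size_cat leq_addr.
rewrite big_mkord (bigD1 (Ordinal ws)) //= eqxx big1 ?addr0 // => q.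
by rewrite -val_eqE /= => /negbTE ->.
Qed.

Lemma Brooks_occ_sum w g : w <> 1%g ->
  Brooks R w g =
  occ_sum (fun u => (u == w)%:R - (u == w^-1%g)%:R) (fun=> 1) (word g).
Proof.
move=> w1; have w1' : w^-1%g <> 1%g by move/eqP; rewrite invg_eq1 => /eqP.
rewrite /Brooks /occurrences; have := word_reduced g.
elim: (word g) => [|x s IH] rs; first by rewrite subrr.
have count_cons v : count (fun i => prefix v (drop i (x :: s))) (iota 0 (size s).+1)
    = (prefix v (x :: s) + count (fun i => prefix v (drop i s)) (iota 0 (size s)))%N.
  by rewrite /= -[1%N]/(1 + 0)%N iotaDl count_map.
rewrite !count_cons [RHS]/= -IH ?(reduced_behead rs) // !natrD.
have -> : prefix_sum (fun u => (u == w)%:R - (u == w^-1%g)%:R) (fun=> 1) (x :: s)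
    = (prefix w (x :: s))%:R - (prefix w^-1%g (x :: s))%:R :> R.
  rewrite -!prefix_sum1 // -sumrB /prefix_sum; apply: eq_bigr => q _.
  by rewrite (_ : (1 + 1) / 2 = 1 :> R) ?mulr1 //; field.
ring.
Qed.

(** Alternation lets each subword [u] of [g] carry the weight [alpha u] directly, whichever of [u]
    and its inverse lies in [P]. *)
Lemma phi_alpha_occ_sum (P : set F) (alpha : F -> R) :
  half_system P -> Defs.alternating alpha ->
  supported_on alpha (@non_self_overlapping n) ->
  phi_alpha P alpha = fun g => occ_sum alpha (fun=> 1) (word g).
Proof.
move=> [PN Phalf] alt supp; apply/funext => g.
(* This settles the empty word, which [half_system] allows in [P]. *)
have alpha1 : alpha 1%g = 0 by have := alt 1%g; rewrite invg1; lra.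
pose A := P `&` [set w | w <> 1%g] `&` [set w : F | (size (word w) <= size (word g))%N].
have finA : finite_set A.
  by apply: sub_finite_set (finite_words n (size (word g))) => w [].
rewrite /phi_alpha -(@fsbig_widen _ _ _ _ A); last 2 first.
- by move=> w [[]].
- move=> w [Pw nA] /=; have [->|/eqP w1] := eqVneq w 1%g; first by rewrite alpha1 mul0r.
  rewrite Brooks_eq0 ?mulr0 // ltnNge; apply/negP => le_wg; exact: nA.
rewrite fsbig_finite //=.
have memA w : w \in fset_set A <-> A w by rewrite in_fset_set // in_setE.
transitivity (\sum_(w <- fset_set A) alpha w *
    occ_sum (fun u => (u == w)%:R - (u == w^-1%g)%:R) (fun=> 1) (word g)).
  rewrite big_seq [RHS]big_seq; apply: eq_bigr => w /memA[[_ w1] _].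
  by rewrite Brooks_occ_sum.
(* Exchanging the sums leaves a comparison of weights at each nonempty [u] no longer than [g]. *)
rewrite -occ_sum_sum; apply: eq_occ_sum => [|u u1 ug]; first exact: word_reduced.
have sizeV : size (word u^-1%g) = size (word u) by rewrite /= size_invw.
have u1' : u^-1%g <> 1%g by move/eqP; rewrite invg_eq1 => /eqP.
have neqV : P u <> P u^-1%g -> (u == u^-1%g) = false.
  by move=> H; apply/eqP => e; apply: H; rewrite -e.
have only v : v \in fset_set A ->
    (forall w, w \in fset_set A -> w != v -> (u == w) = false /\ (u == w^-1%g) = false) ->
    \sum_(w <- fset_set A) alpha w * ((u == w)%:R - (u == w^-1%g)%:R)
    = alpha v * ((u == v)%:R - (u == v^-1%g)%:R).
  move=> vA H; rewrite (bigD1_seq v) ?fset_uniq //= big_seq_cond big1 ?addr0 //.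
  by move=> w /andP[wA wv]; have [-> ->] := H w wA wv; rewrite subrr mulr0.
have inA v : P v -> v <> 1%g -> size (word v) = size (word u) -> v \in fset_set A.
  by move=> Pv v1 sv; apply/memA; split=> //=; rewrite sv.
have Pof v : v \in fset_set A -> P v by move=> /memA[[]].
have [Pu|nPu] := pselect (P u).
  have [[_ nPu']|[//]] := Phalf u u1 (PN _ Pu).
  rewrite (only u); [|exact: inA|].
    by rewrite eqxx neqV ?subr0 ?mulr1 // => e; apply: nPu'; rewrite -e.
  move=> w /Pof Pw wu; rewrite eq_sym (negbTE wu); split => //.
  by apply/eqP => e; apply: nPu'; rewrite e invgK.
have [Pu'|nPu'] := pselect (P u^-1%g).
  rewrite (only u^-1%g); [|exact: inA|].
    rewrite invgK eqxx neqV ?alt ?sub0r ?mulrNN ?mulr1 // => e.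
    by apply: nPu; rewrite e.
  move=> w /Pof Pw wu; split; first by apply/eqP => e; apply: nPu; rewrite e.
  by apply/eqP => e; move/eqP: wu; apply; rewrite e invgK.
(* Neither [u] nor its inverse is in [P]: all terms vanish, and so does [alpha u], since [u] is then
   self-overlapping. *)
rewrite big_seq big1; last first.
  move=> w /Pof Pw; case: eqP => [e|_]; first by case: nPu; rewrite e.
  by case: eqP => [e|_]; [case: nPu'; rewrite e invgK|rewrite subrr mulr0].
apply/esym/eqP/negPn/negP => /supp uN.
by have [[]|[]] := Phalf u u1 uN.
Qed.

End BrooksOccurrences.

(** * Rolli quasimorphisms as sums over syllables *)

Section RolliSums.
Variables (R : realType) (n : nat).
Local Notation F := (FreeGroup n).
Variable lambda : 'I_n -> int -> R.
Implicit Types (f : F -> R) (s t : seq ('I_n * int)).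

(** The analogue of [occ_sum] in which the marked pieces are whole syllables. *)
Fixpoint syl_sum f s : R :=
  if s is p :: s' then
    lambda p.1 p.2 * ((f (fg_of (spell s)) + f (fg_of (spell s'))) / 2)
    + syl_sum f s'
  else 0.

Lemma syl_sum_linear f f' c s :
  syl_sum (fun z => f z - f' z + c) s
  = syl_sum f s - syl_sum f' s + c * syl_sum (fun=> 1) s.
Proof. by elim: s => [|p s IH] /=; [ring|rewrite IH; field]. Qed.

Lemma spell_cat s t : spell (s ++ t) = spell s ++ spell t.
Proof. by rewrite /spell map_cat flatten_cat. Qed.

Lemma syl_sum_cat f s t :
  syl_sum f (s ++ t)
  = syl_sum (fun z => f (z * fg_of (spell t))%g) s + syl_sum f t.
Proof.
elim: s => [|p s IH]; first by rewrite add0r.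
by rewrite cat_cons /= IH -cat_cons !spell_cat !fg_of_cat addrA.
Qed.

Lemma syl_sum1 s : syl_sum (fun=> 1) s = \sum_(p <- s) lambda p.1 p.2.
Proof.
elim: s => [|p s IH]; first by rewrite big_nil.
by rewrite big_cons /= IH; field.
Qed.

Definition syl_inv s := rev [seq (p.1, - p.2) | p <- s].

Lemma spell_syl_inv s : spell (syl_inv s) = invw (spell s).
Proof.
elim: s => [//|[i m] s IH].
rewrite /syl_inv map_cons rev_cons -cats1 spell_cat -/(syl_inv s) IH.
rewrite -[in RHS]cat1s [in RHS]spell_cat invw_cat; congr (_ ++ _).
rewrite /spell /= !cats0 abszN /invw map_nseq rev_nseq /invl /=.
by case: m => [[|k]|k].
Qed.

Lemma syl_inv_normal s : power_normal_form s -> power_normal_form (syl_inv s).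
Proof.
move=> /andP[s0 ss]; apply/andP; split.
  by rewrite all_rev all_map; apply: sub_all s0 => p /=; rewrite oppr_eq0.
rewrite rev_sorted sorted_map; apply: sub_sorted ss => p q /=.
by rewrite eq_sym.
Qed.

Lemma power_normal_syllables (g : F) : power_normal_form (syllables g).
Proof. by case: (spell_syllables (word_reduced g)). Qed.

Lemma spell_syllablesE (g : F) : spell (syllables g) = word g.
Proof. by case: (spell_syllables (word_reduced g)). Qed.

Lemma syllables_eq (g : F) s : power_normal_form s -> spell s = word g ->
  syllables g = s.
Proof. by rewrite /syllables => ns <-; apply: syllables_spell. Qed.

Lemma syllablesV (g : F) : syllables g^-1%g = syl_inv (syllables g).
Proof.
apply: syllables_eq; first exact/syl_inv_normal/power_normal_syllables.
by rewrite spell_syl_inv spell_syllablesE.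
Qed.

Lemma syl_sum_inv f s : (forall i m, lambda i (- m) = - lambda i m) ->
  syl_sum (fun z => f (z * (fg_of (spell s))^-1)%g) s = - syl_sum f (syl_inv s).
Proof.
move=> lN; elim: s f => [|p s IH] f; first by rewrite oppr0.
rewrite /syl_inv map_cons rev_cons -cats1 -/(syl_inv s) syl_sum_cat /= lN.
set q := (p.1, - p.2).
have eq : fg_of (spell [:: q]) = (fg_of (spell [:: p]))^-1%g.
  by rewrite -fg_of_invw -spell_syl_inv.
have -> : (fun z => f (z * (fg_of (spell (p :: s)))^-1)%g) =
    (fun z => (fun y => f (y * fg_of (spell [:: q]))%g) (z * (fg_of (spell s))^-1)%g).
  by apply/funext => z; rewrite -cat1s spell_cat fg_of_cat invgM mulgA eq.
rewrite (IH (fun y => f (y * fg_of (spell [:: q]))%g)) /= mulgV.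
have -> : (fg_of (spell s) * (fg_of (spell (p :: s)))^-1)%g = fg_of (spell [:: q]).
  by rewrite -cat1s spell_cat fg_of_cat invgM mulgA mulgV mul1g eq.
rewrite (_ : fg_of (spell [::]) = 1%g) ?fg_of_nil //.
ring.
Qed.

(** Across a reduced cut, at most the last syllable of [a] and the first of [b] merge, namely when
    they are powers of the same generator. *)
Lemma syllables_cat (a b : F) : reduced (word a ++ word b) ->
  syllables (a * b)%g = syllables a ++ syllables b \/
  exists s t i m m', [/\ syllables a = rcons s (i, m), syllables b = (i, m') :: t
    & syllables (a * b)%g = s ++ (i, m + m') :: t].
Proof.
move=> rab; have /wordM_reduced eab := rab.
have := power_normal_syllables a; have := power_normal_syllables b.
have := spell_syllablesE a; have := spell_syllablesE b.
case: (lastP (syllables a)) => [|s [i m]].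
  move=> eb ea nb _; left; apply: syllables_eq => //.
  by rewrite eab -eb -ea.
case: (syllables b) => [|[j m'] t].
  move=> eb ea _ na; left; apply: syllables_eq; rewrite ?cats0 //.
  by rewrite eab -eb -ea cats0.
move=> eb ea; rewrite /power_normal_form.
pose r := [rel x y : 'I_n | x != y].
have sortE u :
    sorted (fun p q : 'I_n * int => p.1 != q.1) u = sorted r [seq p.1 | p <- u].
  by rewrite sorted_map.
rewrite !sortE => /andP[/= /andP[m'0 t0] pt].
rewrite all_rcons /= => /andP[/andP[m0 s0]].
rewrite map_rcons /= => srt.
have [ij|ij] := eqVneq i j; last first.
  left; apply: syllables_eq; last by rewrite eab -eb -ea spell_cat.
  rewrite /power_normal_form sortE map_cat map_rcons /= all_cat all_rcons /=.
  rewrite m0 s0 m'0 t0 /= cat_rcons sorted_cat_cons srt /=.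
  by rewrite ij pt.
right; exists s, t, i, m, m'; split => //; first by rewrite ij.
subst j.
(* Opposite signs would put a letter next to its inverse at the cut; equal signs make the lengths
   add. *)
have mm : (m < 0) = (m' < 0).
  move: rab; rewrite -ea -eb -cats1 spell_cat /spell /= cats0.
  have -> : `|m|%N = (`|m|.-1 + 1)%N by rewrite addn1 prednK // absz_gt0.
  have -> : `|m'|%N = (`|m'|.-1)%N.+1 by rewrite prednK // absz_gt0.
  rewrite nseqD -!catA => /reduced_catr/reduced_catr.
  rewrite /reduced /= xpair_eqE eqxx /=.
  by move=> /andP[+ _]; case: (m < 0); case: (m' < 0).
apply: syllables_eq.
  rewrite /power_normal_form sortE map_cat /= all_cat /= s0 t0 andbT.
  rewrite sorted_cat_cons srt pt !andbT; lia.
rewrite eab -ea -eb -cats1 !spell_cat -catA; congr (_ ++ _).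
rewrite /spell /= cats0 catA; congr (_ ++ _).
have -> : absz (m + m') = (`|m| + `|m'|)%N by lia.
have -> : (m + m' < 0) = (m < 0) by lia.
by rewrite -mm nseqD.
Qed.

Lemma Rolli_cut_additive M : 0 <= M ->
  (forall i m, `|lambda i m| <= M) ->
  (forall i m, lambda i (- m) = - lambda i m) ->
  cut_additive (3 * M) (fun f g => syl_sum f (syllables g)).
Proof.
move=> M0 lM lN; split.
- by move=> f f' c g; apply: syl_sum_linear.
- move=> f g; rewrite syllablesV -syl_sum_inv //.
  by rewrite spell_syllablesE fg_of_word.
move=> f D a b fD rab.
have D0 : 0 <= D by apply: le_trans (fD 1%g).
case: (syllables_cat rab) => [->|[s [t [i [m [m' [ea eb eab]]]]]]].
  rewrite syl_sum_cat spell_syllablesE fg_of_word addrAC addrK subrr normr0.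
  by rewrite !mulr_ge0.
have bound i' m1 x y : `|lambda i' m1 * ((f x + f y) / 2)| <= M * D.
  rewrite normrM ler_pM //.
  have := fD x; have := fD y; rewrite !ler_norml; lra.
(* The tail of [a * b] from the merged syllable on, which is also the last syllable of [a] times
   [b]. *)
pose tl := fg_of (spell ((i, m + m') :: t)).
have btl : (fg_of (spell [:: (i, m)]) * b = tl)%g.
  apply: (@mulgI _ (fg_of (spell s))); rewrite mulgA -!fg_of_cat -!spell_cat.
  by rewrite cats1 -ea -eab !spell_syllablesE !fg_of_word.
rewrite eab ea eb -cats1 !syl_sum_cat /= -/tl.
have -> : (fun z => f (z * fg_of (spell [:: (i, m)]) * b)%g) =
    (fun z => f (z * tl)%g).
  by apply/funext => z; rewrite -mulgA btl.
(* The error consists of the merged syllable and its two halves, whence 3 M. *)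
have := bound i (m + m') tl (fg_of (spell t)).
have := bound i m (fg_of (spell [:: (i, m)]) * b)%g (fg_of (spell [::]) * b)%g.
have := bound i m' (fg_of (spell ((i, m') :: t))) (fg_of (spell t)).
rewrite !ler_norml; lra.
Qed.

Lemma Rolli_syl_sum : Rolli lambda = fun g => syl_sum (fun=> 1) (syllables g).
Proof. by apply/funext => g; rewrite syl_sum1. Qed.

End RolliSums.

(** * Defect of the weighted sum and the final constants *)

Section Main.
Variables (R : realType) (n : nat).
Local Notation F := (FreeGroup n).

Lemma defect_psi_beta (beta : F -> R) :
  (defect (psi_beta beta) <= Brooks_weight beta)%E.
Proof.
apply: ge_ereal_sup => _ [t _ <-]; rewrite delta1_tnth.
move: (tnth t ord0) (tnth t ord_max) => g h.
(* With this bound the values at g, h and g h become sums over one finite set of words. *)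
pose N := (size (word g) + size (word h) + size (word (g * h)%g))%N.
pose A := [set w | w <> 1%g] `&` [set w : F | (size (word w) <= N)%N].
have finA : finite_set A by apply: sub_finite_set (finite_words n N) => w [].
have psiE x : (size (word x) <= N)%N ->
    psi_beta beta x = \sum_(w <- fset_set A) beta w * Brooks R w x.
  move=> xN; rewrite /psi_beta -fsbig_finite //; apply/esym/fsbig_widen.
    by move=> w [].
  move=> w [w1 nA] /=; rewrite Brooks_eq0 ?mulr0 // (leq_ltn_trans xN) //.
  by rewrite ltnNge; apply/negP => wN; apply: nA.
rewrite !psiE /N; [|lia..].
rewrite -big_split -sumrB /=.
apply: (@le_trans _ _ (\sum_(w <- fset_set A)
    ((size (word w))%:R * `|beta w|)%:E * defect (Brooks R w))%E); last first.
  by apply: esum_ge; exists A; [split=> // w []|rewrite fsbig_finite].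
apply: (@le_trans _ _ (\sum_(w <- fset_set A)
    (`|beta w| * `|Brooks R w g + Brooks R w h - Brooks R w (g * h)%g|)%:E)%E).
  rewrite sumEFin lee_fin (le_trans (ler_norm_sum _ _ _)) //.
  by apply: ler_sum => w _; rewrite -normrM -mulrDr -mulrBr.
rewrite big_seq [leRHS]big_seq; apply: lee_sum => w.
rewrite in_fset_set // in_setE => -[w1 _]; rewrite EFinM.
apply: lee_pmul; rewrite ?lee_fin //; last first.
  by rewrite -delta1E; apply: sup_norm_ge.
(* A nontrivial word has length at least 1, so the factor |w| only enlarges the bound. *)
rewrite ler_peMl // ler1n lt0n size_eq0; apply/eqP => e.
by apply: w1; apply: val_inj.
Qed.

(** Common end of both cases: the norm is at most 3 C D(psi), with C at most 3 x and D(psi) at most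
    [Brooks_weight beta]. *)
Lemma cut_additive_cup_psi (C : R) (E : (F -> R) -> F -> R) (phi : F -> R)
    (beta : F -> R) (x : \bar R) :
  cut_additive C E -> phi = E (fun=> 1) -> (Brooks_weight beta < +oo)%E ->
  x \is a fin_num -> (0 <= x)%E -> C <= 3 * fine x ->
  [/\ quasimorphism phi, quasimorphism (psi_beta beta),
      Hb_cup (Hb_class (delta1 phi)) (Hb_class (delta1 (psi_beta beta)))
        = @Hb_zero R F 4
    & exists p : cochain R F 3,
        is_primitive (cup (delta1 phi) (delta1 (psi_beta beta))) p /\
        (sup_norm p <= 9%:E * (x * Brooks_weight beta))%E].
Proof.
move=> EC -> W_lty x_fin x0 Cx.
have dW := defect_psi_beta beta.
have qpsi : quasimorphism (psi_beta beta) by apply: le_lt_trans W_lty.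
have [qphi cup0 [p [prim ple]]] := cut_additive_cup EC qpsi.
split => //; exists p; split => //; apply: le_trans ple _.
have W0 := le_trans (defect_ge0 _) dW.
have W_fin : Brooks_weight beta \is a fin_num by rewrite ge0_fin_numE.
have d_fin : defect (psi_beta beta) \is a fin_num.
  by rewrite ge0_fin_numE // defect_ge0.
have d0 := fine_ge0 (defect_ge0 (psi_beta beta)).
have xr0 := fine_ge0 x0.
rewrite -(fineK W_fin) -(fineK x_fin) -!EFinM lee_fin.
have {dW} : fine (defect (psi_beta beta)) <= fine (Brooks_weight beta).
  exact: fine_le.
move: (fine _) (fine _) (fine _) d0 xr0 Cx => w d y d0 y0 Cy dw.
have := ler_wpM2r d0 Cy; have := ler_wpM2l y0 dw; lra.
Qed.

Lemma Rolli_norm_fin (lambda : 'I_n -> int -> R) : Rolli_param lambda ->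
  [/\ Rolli_norm lambda \is a fin_num, (0 <= Rolli_norm lambda)%E &
    forall i m, `|lambda i m| <= fine (Rolli_norm lambda)].
Proof.
move=> lP.
have N0 : (0 <= Rolli_norm lambda)%E.
  by rewrite /Rolli_norm; elim/big_ind: _ => // [x y x0 y0|i _];
    rewrite ?le_max ?x0 // (le_trans _ (sup_norm_ge _ 0)).
have N_lty : (Rolli_norm lambda < +oo)%E.
  rewrite /Rolli_norm; elim/big_ind: _ => [|x y x0 y0|i _]; first exact: ltry.
    by rewrite gt_max x0 y0.
  by have [] := lP i.
have N_fin : Rolli_norm lambda \is a fin_num by rewrite ge0_fin_numE.
split => // i m; rewrite -lee_fin fineK //.
apply: le_trans (sup_norm_ge (lambda i) m) _.
by rewrite /Rolli_norm (bigD1 i) //= le_max lexx.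
Qed.

End Main.

Theorem theorem4p23 (R : realType) :
  exists K : R, (0 < K)%R /\
  forall (n : nat), (1 < n)%N ->
  forall beta : FreeGroup n -> R, (Brooks_weight beta < +oo)%E ->
  (forall (P : set (FreeGroup n)) (alpha : FreeGroup n -> R),
     half_system P -> ell1_Ind alpha ->
     [/\ quasimorphism (phi_alpha P alpha),
         quasimorphism (psi_beta beta),
         Hb_cup (Hb_class (delta1 (phi_alpha P alpha)))
                (Hb_class (delta1 (psi_beta beta)))
           = @Hb_zero R (FreeGroup n) 4
       & exists p : cochain R (FreeGroup n) 3,
           is_primitive
             (cup (delta1 (phi_alpha P alpha)) (delta1 (psi_beta beta))) p /\
           (sup_norm p <= K%:E * (SInd alpha * Brooks_weight beta))%E])
  /\
  (forall lambda : 'I_n -> int -> R,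
     Rolli_param lambda ->
     [/\ quasimorphism (Rolli lambda),
         quasimorphism (psi_beta beta),
         Hb_cup (Hb_class (delta1 (Rolli lambda)))
                (Hb_class (delta1 (psi_beta beta)))
           = @Hb_zero R (FreeGroup n) 4
       & exists p : cochain R (FreeGroup n) 3,
           is_primitive
             (cup (delta1 (Rolli lambda)) (delta1 (psi_beta beta))) p /\
           (sup_norm p <= K%:E * (Rolli_norm lambda * Brooks_weight beta))%E]).
Proof.
(* Three cuts, with an error per cut of at most three times the norm: [SInd alpha] once for Brooks
   sums, [Rolli_norm lambda] three times for Rolli. *)
exists 9; split=> // n _ beta W_lty; split=> [P alpha halfP al1|lambda lP].
  have [alt supp _] := al1; have [S_fin S0] := SInd_fin_num al1.
  have Sr0 := fine_ge0 S0.
  apply: cut_additive_cup_psi (occ_sum_cut_additive al1) _ W_lty S_fin S0 _.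
    exact: phi_alpha_occ_sum.
  by lra.
have [N_fin N0 lN] := Rolli_norm_fin lP.
have EC := Rolli_cut_additive (fine_ge0 N0) lN (fun i => (lP i).2).
exact: cut_additive_cup_psi EC (Rolli_syl_sum lambda) W_lty N_fin N0 (lexx _).
Qed.
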